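(* For every connected $2$-degenerate graph $G$ on $n \geq 3$ vertices, there is a strongly separating path system $\mathcal{P}$ for $G$ with exactly $n$ paths such that (i) every edge of $G$ lies in exactly two paths of $\mathcal{P}$, and (ii) for every vertex $v$ of $G$, there are exactly two paths in $\mathcal{P}$ having $v$ as an endpoint.
   Context: All graphs are finite and simple. A graph $G$ is $2$-degenerate if every subgraph of $G$ contains a vertex of degree at most $2$. Given a collection $\mathcal{P}$ of paths in a graph $G$, two edges $e,f$ of $G$ are separated by $\mathcal{P}$ if there are paths $P_e,P_f\in\mathcal{P}$ such that $P_e$ contains $e$ but not $f$, and $P_f$ contains $f$ but not $e$. $\mathcal{P}$ is a strongly separating path system of $G$ if it separates every pair of distinct edges of $G$. *)

(* Defs.v *)
From mathcomp Require Import all_boot.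

Set Implicit Arguments.
Unset Strict Implicit.
Unset Printing Implicit Defensive.

Record sgraph := SGraph {
  vert :> finType;
  adj : rel vert;
  adj_sym : symmetric adj;
  adj_irr : irreflexive adj }.

(* An edge is the 2-element set of its ends. *)
Definition edges (G : sgraph) : {set {set G}} :=
  [set e : {set G} | [exists x, exists y, adj x y && (e == [set x; y])]].

Definition connected (G : sgraph) : Prop :=
  forall x y : G, connect (@adj G) x y.

(* (S, F) is a subgraph of G, not necessarily induced. *)
Definition subgraph (G : sgraph) (S : {set G}) (F : {set {set G}}) : bool :=
  (F \subset edges G) && (F \subset powerset S).

Definition degree (G : sgraph) (F : {set {set G}}) (v : G) : nat :=
  #|[set e in F | v \in e]|.

(* As usual, the subgraph without vertices is not considered. *)
Definition degenerate (k : nat) (G : sgraph) : Prop :=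
  forall (S : {set G}) (F : {set {set G}}), subgraph S F -> S != set0 ->
    exists2 v : G, v \in S & degree F v <= k.

(* A path is given by the sequence of its vertices, in order; a sequence and
   its reverse describe the same path. *)
Definition graph_path (G : sgraph) (p : seq G) : bool :=
  [&& p != [::], sorted (@adj G) p & uniq p].

Definition same_path (G : sgraph) (p q : seq G) : bool :=
  (p == q) || (p == rev q).

Definition path_edges (G : sgraph) (p : seq G) : seq {set G} :=
  if p is x :: q then pairmap (fun u w => [set u; w]) x q else [::].

Definition endpoint (G : sgraph) (v : G) (p : seq G) : bool :=
  if p is x :: q then (v == x) || (v == last x q) else false.

(* A set of paths, listed without repetition, so that size and count give
   cardinalities. *)
Definition path_collection (G : sgraph) (P : seq (seq G)) : bool :=
  all (@graph_path G) P && pairwise (fun p q => ~~ same_path p q) P.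

Definition separated (G : sgraph) (P : seq (seq G)) (e f : {set G}) : Prop :=
  (exists2 p, p \in P & (e \in path_edges p) && (f \notin path_edges p)) /\
  (exists2 p, p \in P & (f \in path_edges p) && (e \notin path_edges p)).

Definition strongly_separating (G : sgraph) (P : seq (seq G)) : Prop :=
  path_collection P /\
  forall e f : {set G}, e \in edges G -> f \in edges G -> e != f ->
    separated P e f.

(* Main.v *)
(** The paths are built edge by edge, starting from the [n] one-vertex paths, each
of which has both of its ends at its only vertex.  To add an edge [uv], take two
edge-disjoint paths, [p] ending in [u] and avoiding [v], and [q] ending in [v]
and avoiding [u], and extend both along [uv]: the number of path ends at each
vertex is unchanged, and [uv] is the only edge that the two new paths share.  In
a 2-degenerate ordering each new vertex [v] has at most two earlier neighbours
[u], [w], and such paths exist: [[:: v]] and any path ending in [u], then the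
resulting path [vu] and another path ending in [w].  An edge lies in two paths
and two edges share at most one, so edges are strongly separated.  Connectivity
is only needed to exclude one-vertex paths and repeated one-edge paths. *)

Require Import Defs.
From mathcomp Require Import all_boot.
From mathcomp Require Import zify.

Set Implicit Arguments.
Unset Strict Implicit.
Unset Printing Implicit Defensive.

(* A one-vertex path has two ends at its vertex. *)
Definition ends (G : sgraph) (x : G) (p : seq G) : nat :=
  if p is y :: q then (y == x) + (last y q == x) else 0.

(* [ps_local] says that paths with both ends used up inside [{x, y}] occur only
   when [x] has no neighbour except possibly [y]; it rules out one-vertex paths
   (with [x = y]) and repeated edges in larger connected graphs. *)
Record path_system (G : sgraph) (F : {set {set G}}) (P : seq (seq G)) : Prop :=
  PathSystem {
    ps_path : all (@graph_path G) P;
    ps_size : size P = #|G|;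
    ps_ends : forall x, \sum_(p <- P) ends x p = 2;
    ps_cover : forall e, count (fun p => e \in path_edges p) P = (e \in F).*2;
    ps_sep : forall e f, e != f ->
      count (fun p => (e \in path_edges p) && (f \in path_edges p)) P <= 1;
    ps_local : forall x y z,
      (forall p, p \in P -> 0 < ends x p -> {subset p <= [set x; y]}) ->
      [set x; z] \in F -> z = y }.

(** * Edges and ends of a path, and their invariance under reversal *)

Lemma path_edges_rcons2 (G : sgraph) (p : seq G) (x y : G) :
  path_edges (rcons (rcons p x) y) = rcons (path_edges (rcons p x)) [set x; y].
Proof.
case: p => [//|z p] /=.
elim: p z => [//|t p IHp] z /=.
by rewrite IHp.
Qed.

Lemma mem_path_edges_rev (G : sgraph) (p : seq G) (e : {set G}) :
  (e \in path_edges (rev p)) = (e \in path_edges p).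
Proof.
elim: p => [//|x [//|y p] IHp].
rewrite !rev_cons path_edges_rcons2 mem_rcons -rev_cons in_cons IHp /=.
by rewrite [in RHS]in_cons setUC.
Qed.

Lemma mem_path_edges_sub (G : sgraph) (p : seq G) (e : {set G}) :
  e \in path_edges p -> {subset e <= p}.
Proof.
elim: p => [//|x [//|y p] IHp]; rewrite [path_edges _]/= in_cons.
case/predU1P => [-> z|/IHp sub z /sub zp]; last by rewrite in_cons zp orbT.
by rewrite !inE orbA => ->.
Qed.

Lemma path_edges_cover (G : sgraph) (p : seq G) (x : G) :
  x \in p -> 1 < size p -> exists2 e, e \in path_edges p & x \in e.
Proof.
case: p => [//|y p]; elim: p y => [//|z p IHp] y; rewrite in_cons.
case/predU1P => [-> _|xzp _].
  by exists [set y; z]; rewrite ?set21 //= in_cons eqxx.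
case: p => [|t p] in IHp xzp *.
  exists [set y; z]; first by rewrite /= in_cons eqxx.
  by move: xzp; rewrite !inE => ->; rewrite orbT.
have [e e_in xe] := IHp z xzp isT.
by exists e => //; rewrite [path_edges _]/= in_cons e_in orbT.
Qed.

Lemma graph_path_rev (G : sgraph) (p : seq G) :
  graph_path (rev p) = graph_path p.
Proof.
rewrite /graph_path rev_uniq rev_sorted -!size_eq0 size_rev.
by congr [&& _, _ & _]; apply: eq_sorted => x y; rewrite adj_sym.
Qed.

Lemma ends_rev (G : sgraph) (x : G) (p : seq G) : ends x (rev p) = ends x p.
Proof.
case/lastP: p => [//|p y]; rewrite rev_rcons.
case: p => [//|z p] /=; first by rewrite rev_cons !last_rcons addnC.
Qed.

(** * Path systems: symmetries, the initial system, isolated vertices *)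

Lemma path_system_perm (G : sgraph) (F : {set {set G}}) (P Q : seq (seq G)) :
  perm_eq P Q -> path_system F P -> path_system F Q.
Proof.
move=> PQ [Hp Hs He Hc Hsep Hl]; split.
- by rewrite -(perm_all _ PQ).
- by rewrite -(perm_size PQ).
- by move=> x; rewrite -(He x) (perm_big _ PQ).
- by move=> e; rewrite -Hc; apply/esym/permP.
- by move=> e f ef; rewrite -(permP PQ); apply: Hsep.
- by move=> x y z H; apply: Hl => p pP; apply: H; rewrite -(perm_mem PQ).
Qed.

Lemma path_system_rev (G : sgraph) (F : {set {set G}}) (p : seq G) P :
  path_system F (p :: P) -> path_system F (rev p :: P).
Proof.
case=> [Hp Hs He Hc Hsep Hl]; split => //.
- by rewrite /= graph_path_rev.
- by move=> x; rewrite -(He x) !big_cons ends_rev.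
- by move=> e; rewrite -Hc /= mem_path_edges_rev.
- by move=> e f /Hsep; rewrite /= !mem_path_edges_rev.
- move=> x y z H; apply: Hl => q; rewrite in_cons => /predU1P[->|qP].
    rewrite -ends_rev => /(H _ (mem_head _ _)) sub t tp.
    by apply: sub; rewrite mem_rev.
  by apply: H; rewrite in_cons qP orbT.
Qed.

Lemma path_system_trivial (G : sgraph) :
  path_system set0 [seq [:: x] | x <- enum G].
Proof.
split.
- by apply/allP => p /mapP[x _ ->].
- by rewrite size_map -cardE.
- move=> x; rewrite big_map big_enum /= (bigD1 x) //= eqxx big1 // => y.
  by move/negPf => ->.
- by move=> e; rewrite inE count_map; apply/eqP;
    rewrite -leqn0 leqNgt -has_count -all_predC; apply/allP.
- by move=> e f _; rewrite count_map (@eq_count _ _ pred0) ?count_pred0.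
- by move=> x y z _; rewrite inE.
Qed.

Lemma graph_path_cons (G : sgraph) (x y : G) (p : seq G) :
  graph_path (x :: y :: p) = [&& adj x y, x \notin y :: p & graph_path (y :: p)].
Proof. by rewrite /graph_path /= -!andbA; do !bool_congr. Qed.

Lemma mem_path_edges_F (G : sgraph) (F : {set {set G}}) P p e :
  path_system F P -> p \in P -> e \in path_edges p -> e \in F.
Proof.
move=> HP pP ep; have := ps_cover HP e.
case: (e \in F) => // /eqP; rewrite eqn0Ngt -has_count => /hasP[].
by exists p.
Qed.

(** A path with at least two vertices has an edge at each of its vertices, and all its edges lie in
    [F]. Hence a vertex not yet joined to anything is avoided by every path except its own trivial
    one. *)
Lemma path_system_isolated (G : sgraph) (F : {set {set G}}) P p x :
  path_system F P -> p \in P -> x \in p ->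
  (forall e, e \in F -> x \notin e) -> p = [:: x].
Proof.
move=> HP pP xp xF.
case: (leqP (size p) 1) => [|p2].
  case: p xp {pP} => [//|y [|//]]; by rewrite inE => /eqP->.
have [e ep xe] := path_edges_cover xp p2.
by have := xF e (mem_path_edges_F HP pP ep); rewrite xe.
Qed.

(** * Picking paths by their ends and adding an edge *)

Lemma pick_end (G : sgraph) (x : G) (P : seq (seq G)) :
  0 < \sum_(p <- P) ends x p ->
  exists p P', perm_eq P (p :: P') /\ 0 < ends x p.
Proof.
rewrite lt0n sum_nat_seq_neq0 => /hasP[p pP]; rewrite /= -lt0n => xp.
by exists p, (rem p P); split=> //; apply: perm_to_rem.
Qed.

(** If the end at [x] is the last vertex, the path is reversed. [Q] holds the paths picked before,
    so that the new one is a different member of the list. *)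
Lemma path_system_pick (G : sgraph) (F : {set {set G}}) P Q x :
  path_system F (Q ++ P) -> 0 < \sum_(p <- P) ends x p ->
  exists q P', path_system F ((x :: q) :: Q ++ P').
Proof.
move=> HP /pick_end[p [P' [PP xp]]].
have {}HP : path_system F (p :: Q ++ P').
  apply: path_system_perm HP; rewrite -(permPr (permEl (perm_catCA Q [:: p] P'))).
  by rewrite perm_cat2l.
case: p xp HP {PP} => [//|y p].
have [<-|yx] := eqVneq y x; first by exists p, P'.
rewrite /= (negPf yx); case: eqP => // <- _ /path_system_rev.
by rewrite (lastI y) rev_rcons; eauto.
Qed.

(* If [p] were nonempty, a second path would end at [u] inside [{u, v}]; as [uv]
   is not in [F], it would be [[:: u]], giving [u] three ends. *)
Lemma local_step (G : sgraph) (F : {set {set G}}) P (u v : G) p q :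
  path_system F ((u :: p) :: (v :: q) :: P) -> u != v -> [set u; v] \notin F ->
  u \notin q -> {subset q <= [set u; v]} ->
  (forall r, r \in P -> 0 < ends u r -> {subset r <= [set u; v]}) ->
  forall r, r \in (u :: p) :: (v :: q) :: P -> 0 < ends u r ->
    {subset r <= [set u; v]}.
Proof.
move=> HP uv uvF uq qsub Psub r; rewrite !in_cons => /or3P[/eqP->|/eqP->|]; last first.
- exact: Psub.
- by move=> _ t; rewrite in_cons => /predU1P[->|/qsub//]; rewrite set22.
have /andP[/and3P[_ _ /= /andP[up _]] _] := ps_path HP.
case: p up HP => [|a p] up HP _; first by move=> t; rewrite !inE => ->.
have := ps_ends HP u; rewrite !big_cons /= eqxx (eq_sym v) (negPf uv).
have -> : (last a p == u) = false.
  by apply: contraNF up => /eqP<-; apply: mem_last.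
have -> : (last v q == u) = false.
  apply: contraNF uq => /eqP lu; have := mem_last v q.
  by rewrite lu in_cons (negPf uv).
move=> sumP.
have /pick_end[s [P' [PP us]]] : 0 < \sum_(t <- P) ends u t by lia.
have sP : s \in P by rewrite (perm_mem PP) mem_head.
have ssub := Psub s sP us.
rewrite (perm_big _ PP) big_cons in sumP.
case: s => [//|b [|c s]] in us sP ssub sumP {PP} *.
  move: us sumP => /=; case: (b == u) => //=; lia.
(* The first edge of a path inside [[set u; v]] can only be [uv]. *)
suff bcE : [set b; c] = [set u; v].
  case/negP: uvF; rewrite -bcE.
  apply: (mem_path_edges_F (p := b :: c :: s) HP); last exact: mem_head.
  by rewrite !in_cons sP !orbT.
have := ps_path HP; rewrite /= => /and3P[_ _ /allP/(_ _ sP)].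
rewrite graph_path_cons in_cons negb_or => /and3P[_ /andP[bc _] _].
apply/eqP; rewrite eqEcard !cards2 bc uv leqnn andbT.
by apply/subsetP => t; rewrite in_set2 => /orP[]/eqP->; apply: ssub;
  rewrite !inE eqxx ?orbT.
Qed.

(** The two extended paths exchange an end at [u] for one at [v] and vice versa, so all end counts
    persist. The disjointness hypothesis keeps an old edge from sharing both new paths with [uv]. *)
Lemma path_system_add (G : sgraph) (F : {set {set G}}) P (u v : G) p q :
  path_system F ((u :: p) :: (v :: q) :: P) -> adj u v -> [set u; v] \notin F ->
  u \notin q -> v \notin p ->
  (forall e, e \in path_edges (u :: p) -> e \notin path_edges (v :: q)) ->
  path_system ([set u; v] |: F) ((v :: u :: p) :: (u :: v :: q) :: P).
Proof.
move=> HP auv uvF uq vp dis.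
have uv : u != v by apply: contraTneq auv => ->; rewrite adj_irr.
have vuq : u \notin v :: q by rewrite in_cons negb_or uv.
have uvp : v \notin u :: p by rewrite in_cons negb_or eq_sym uv.
split.
- move: (ps_path HP); rewrite /= !graph_path_cons auv adj_sym auv uvp vuq /=.
  by [].
- exact: ps_size HP.
- move=> x; rewrite -(ps_ends HP x) !big_cons /=; lia.
- move=> e; rewrite in_setU1.
  have := ps_cover HP e; rewrite /= !in_cons (setUC [set v]).
  case: (e =P _) => [->|_ <-//]; move: uvF; case: (_ \in F) => //= _; lia.
(* No path of [P] contains the new edge [e], and [f] lies in at most one of the two extended
   paths. *)
- have HeP e f : e != f -> e = [set u; v] ->
    count (fun p0 => (e \in path_edges p0) && (f \in path_edges p0))
      [:: v :: u :: p, u :: v :: q & P] <= 1.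
    move=> ef eE.
    have := ps_cover HP e; have -> : e \in F = false by rewrite eE (negPf uvF).
    have : count (fun p0 => (e \in path_edges p0) && (f \in path_edges p0)) P
        <= count (fun p0 => e \in path_edges p0) P.
      by apply: sub_count => r /andP[].
    rewrite /= !in_cons (setUC [set v]) -eE eqxx eq_sym (negPf ef) /=.
    rewrite -/(path_edges (u :: p)) -/(path_edges (v :: q)).
    have := dis f; case: (f \in path_edges (u :: p)) => [/(_ isT)/negPf->|_] /=.
      lia.
    case: (f \in path_edges (v :: q)) => /=; lia.
  move=> e f ef.
  have [eE|eE] := eqVneq e [set u; v]; first exact: HeP.
  have [fE|fE] := eqVneq f [set u; v].
    under eq_count do rewrite andbC.
    by apply: HeP => //; rewrite eq_sym.
  have := ps_sep HP ef.
  by rewrite /= !in_cons (setUC [set v]) (negPf eE) (negPf fE).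
move=> x y z H.
(* The new path [u :: v :: q] ends at [u] and passes through [v], so confinement to [[set x; y]]
   determines [y]. *)
have uN : x = u -> y = v.
  move=> xu; have := H (u :: v :: q); rewrite !in_cons eqxx orbT xu /= eqxx.
  move=> /(_ isT isT v); rewrite !inE eqxx orbT eq_sym (negPf uv) => /(_ isT).
  by move/eqP.
have vN : x = v -> y = u.
  move=> xv; have := H (v :: u :: p); rewrite !in_cons eqxx xv /= eqxx.
  move=> /(_ isT isT u); rewrite !inE eqxx orbT (negPf uv) => /(_ isT).
  by move/eqP.
have PH r : r \in P -> 0 < ends x r -> {subset r <= [set x; y]}.
  by move=> rP; apply: H; rewrite !in_cons rP !orbT.
rewrite in_setU1 => /predU1P[E|].
  have : x \in [set u; v] by rewrite -E set21.
  rewrite in_set2 => /orP[]/eqP xE.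
    have : v \in [set x; z] by rewrite E set22.
    by rewrite in_set2 (uN xE) xE eq_sym (negPf uv) => /eqP.
  have : u \in [set x; z] by rewrite E set21.
  by rewrite in_set2 (vN xE) xE (negPf uv) => /eqP.
(* For an old edge, confinement is carried back to the old system. If [x] is [u] or [v], one old
   path may have lost its end at [x] by being extended; [local_step] handles it. *)
apply: (ps_local HP).
have [xu|xu] := eqVneq x u.
  rewrite xu (uN xu) in PH H *; apply: (local_step HP) => // t tq.
  by apply: (H (u :: v :: q)) => /=; rewrite ?eqxx // !in_cons ?eqxx ?tq ?orbT.
have [xv|xv] := eqVneq x v.
  rewrite xv (vN xv) in PH H *.
  have HP' : path_system F ((v :: q) :: (u :: p) :: P).
    by apply: path_system_perm HP; rewrite (permEl (perm_catCA [:: _] [:: _] P)).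
  have vuF : [set v; u] \notin F by rewrite setUC.
  have st := @local_step _ _ _ _ _ _ _ HP' _ vuF vp.
  move=> r rP; apply: st => //; first by rewrite eq_sym.
    move=> t tp.
    by apply: (H (v :: u :: p)) => /=; rewrite ?eqxx // !in_cons ?eqxx ?tp ?orbT.
  by move: rP; rewrite !in_cons orbCA.
(* Now [x] is neither [u] nor [v], so an end at [x] is a last vertex, which the extension leaves in
   place. *)
move=> r; rewrite !in_cons => /or3P[/eqP->|/eqP->|]; last exact: PH.
  rewrite /= eq_sym (negPf xu) => xl t tp.
  apply: (H (v :: u :: p)); rewrite ?mem_head //=; first by lia.
  by rewrite in_cons tp orbT.
rewrite /= eq_sym (negPf xv) => xl t tp.
apply: (H (u :: v :: q)); rewrite ?in_cons ?eqxx ?orbT //=; first by lia.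
by rewrite -in_cons tp orbT.
Qed.

(** * Induced edge sets and the degenerate ordering *)

(** The vertex type stays [G], so that every intermediate system already has [#|G|] paths. *)
Definition edges_in (G : sgraph) (S : {set G}) : {set {set G}} :=
  [set e in edges G | e \subset S].

Lemma edgeP (G : sgraph) (e : {set G}) :
  reflect (exists x y, adj x y /\ e = [set x; y]) (e \in edges G).
Proof.
rewrite inE; apply: (iffP existsP) => [[x /existsP[y /andP[xy /eqP->]]]|[x [y [xy ->]]]].
  by exists x, y.
by exists x; apply/existsP; exists y; rewrite xy eqxx.
Qed.

Lemma mem_edges (G : sgraph) (x y : G) : adj x y -> [set x; y] \in edges G.
Proof. by move=> xy; apply/edgeP; exists x, y. Qed.

Lemma edges_inD1 (G : sgraph) (S : {set G}) (v : G) : v \in S ->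
  edges_in S =
  [set [set v; z] | z in [set z in S | adj v z]] :|: edges_in (S :\ v).
Proof.
move=> vS; apply/setP => e; rewrite in_setU [e \in edges_in S]inE.
rewrite [e \in edges_in (S :\ v)]inE subsetD1.
case: (boolP (v \in e)) => [ve|ve]; last first.
  rewrite andbT; apply/idP/orP => [|[/imsetP[z _ eE]|//]]; first by right.
  by rewrite eE set21 in ve.
rewrite !andbF orbF; apply/andP/imsetP => [[/edgeP[x [y [xy eE]]] eS]|[z]].
  move: ve; rewrite eE in_set2 => /orP[]/eqP vE.
    exists y; last by rewrite vE.
    by rewrite inE vE xy (subsetP eS) ?eE ?set22.
  exists x; last by rewrite vE setUC.
  by rewrite inE vE adj_sym xy (subsetP eS) ?eE ?set21.
rewrite inE => /andP[zS vz] ->; split; first exact: mem_edges.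
by apply/subsetP => t; rewrite in_set2 => /orP[]/eqP->.
Qed.

(** Degeneracy is applied to the subgraph induced on [S]; [z] maps injectively to the edge
    [[set v; z]]. *)
Lemma degenerate_neighbours (G : sgraph) (k : nat) (S : {set G}) :
  degenerate k G -> S != set0 ->
  exists2 v, v \in S & #|[set z in S | adj v z]| <= k.
Proof.
move=> hdeg S0; have [|v vS dv] := hdeg S (edges_in S) _ S0.
  by apply/andP; split; apply/subsetP => e; rewrite !inE => /andP[].
exists v => //; apply: leq_trans dv.
rewrite -(card_in_imset (f := fun z => [set v; z])).
  apply: subset_leq_card; rewrite (edges_inD1 vS); apply/subsetP => e eN.
  rewrite inE in_setU eN /=.
  by case/imsetP: eN => z _ ->; rewrite set21.
move=> a b; rewrite !inE => /andP[_ va] _ E.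
have : a \in [set v; b] by rewrite -E set22.
by rewrite in_set2 => /predU1P[av|/eqP//]; rewrite av adj_irr in va.
Qed.

(** Induction on [#|S|]: a vertex [v] with at most two neighbours in [S] is removed, and its edges
    are put back one at a time. *)
Lemma path_system_edges_in (G : sgraph) (S : {set G}) :
  degenerate 2 G -> exists P, path_system (edges_in S) P.
Proof.
move=> hdeg; have [m] := ubnP #|S|; elim: m S => // m IHm S Sm.
have [S0|/(degenerate_neighbours hdeg)[v vS]] := eqVneq S set0.
  exists [seq [:: x] | x <- enum G].
  have -> : edges_in S = set0; last exact: path_system_trivial.
  apply/setP => e; rewrite !inE S0 subset0; apply/negP => /andP[/[swap]/eqP->].
  by case/existsP => x /existsP[y /andP[_ /eqP/setP/(_ x)]]; rewrite !inE eqxx.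
have /IHm[P HP] : #|S :\ v| < m by move: Sm; rewrite (cardsD1 v) vS.
rewrite (edges_inD1 vS); set N := [set z in S | adj v z]; set F := edges_in _ in HP *.
have vF e : e \in F -> v \notin e.
  by rewrite inE => /andP[_]; rewrite subsetD1 => /andP[].
have vzF z : [set v; z] \notin F by apply/negP => /vF; rewrite set21.
have vN z : z \in N -> adj v z by rewrite inE => /andP[].
have nv z : z \in N -> v != z.
  by move=> /vN; apply: contraTneq => <-; rewrite adj_irr.
clearbody N F; rewrite leq_eqVlt ltnS leq_eqVlt ltnS leqn0.
case/or3P => [/cards2P[u [w [uw NE]]]|/cards1P[u NE]|]; last first.
  by rewrite cards_eq0 => /eqP->; rewrite imset0 set0U; exists P.
- have vu : v != u by apply: nv; rewrite NE set11.
  have auv : adj u v by rewrite adj_sym; apply: vN; rewrite NE set11.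
  have [|q0 [P1 HP1]] := path_system_pick (Q := [::]) (x := v) HP.
    by rewrite (ps_ends HP).
  have := path_system_isolated HP1 (mem_head _ _) (mem_head _ _) vF.
  case=> q0E; subst q0.
  have [|p [P2 HP2]] := path_system_pick (Q := [:: [:: v]]) (x := u) HP1.
    have := ps_ends HP1 u; rewrite big_cons /= (negPf vu); lia.
  have vp : v \notin p.
    apply/negP => vp; have vup : v \in u :: p by rewrite in_cons vp orbT.
    have [/eqP] := path_system_isolated HP2 (mem_head _ _) vup vF.
    by rewrite eq_sym (negPf vu).
  eexists; rewrite NE imset_set1 (setUC [set v]).
  by apply: (path_system_add HP2) => //; rewrite setUC.
- have uN : u \in N by rewrite NE set21.
  have wN : w \in N by rewrite NE set22.
  have [vu vw] : v != u /\ v != w by split; apply: nv.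
  have auv : adj u v by rewrite adj_sym; apply: vN.
  have [|q0 [P1 HP1]] := path_system_pick (Q := [::]) (x := v) HP.
    by rewrite (ps_ends HP).
  have := path_system_isolated HP1 (mem_head _ _) (mem_head _ _) vF.
  case=> q0E; subst q0.
  have [|p [P2 HP2]] := path_system_pick (Q := [:: [:: v]]) (x := u) HP1.
    have := ps_ends HP1 u; rewrite big_cons /= (negPf vu); lia.
  (* Since [u :: p] starts at [u], it has at most one end at [w], so another path ends there. *)
  have [|q [P3 HP3]] :=
      path_system_pick (Q := [:: u :: p; [:: v]]) (x := w) HP2.
    have := ps_ends HP2 w; rewrite !big_cons /= (negPf vw) (negPf uw).
    by case: (_ == w) => /=; lia.
  have vnot r : r \in [:: w :: q, u :: p, [:: v] & P3] -> r != [:: v] -> v \notin r.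
    move=> rP; apply: contraNN => vr.
    by apply/eqP; apply: path_system_isolated HP3 rP vr vF.
  have vp : v \notin u :: p.
    by apply: vnot; rewrite ?in_cons ?eqxx ?orbT // eqseq_cons eq_sym (negPf vu).
  have vq : v \notin w :: q.
    by apply: vnot; rewrite ?in_cons ?eqxx ?orbT // eqseq_cons eq_sym (negPf vw).
  have HP4 : path_system F ((u :: p) :: [:: v] :: (w :: q) :: P3).
    apply: path_system_perm HP3.
    exact: (permEl (perm_catCA [:: w :: q] [:: u :: p; [:: v]] P3)).
  have HP5 : path_system ([set u; v] |: F)
      ((v :: u :: p) :: [:: u; v] :: (w :: q) :: P3).
    apply: path_system_add => //; first by rewrite setUC.
    by move: vp; rewrite in_cons negb_or => /andP[].
  (* The edge [vw] extends [[:: v; u]] rather than a path through [p], because [p] may contain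
     [w]. *)
  have /path_system_rev HP6 : path_system ([set u; v] |: F)
      ([:: u; v] :: (w :: q) :: (v :: u :: p) :: P3).
    apply: path_system_perm HP5.
    exact: (permEl (perm_catCA [:: v :: u :: p] [:: [:: u; v]; w :: q] P3)).
  eexists; rewrite NE imsetU1 imset_set1 (setUC [set [set v; u]]) -setUA.
  rewrite (setUC [set v] [set u]).
  apply: (path_system_add HP6); first by rewrite vN.
  + rewrite in_setU1 negb_or vzF andbT.
    apply: contraNneq uw => E; have : w \in [set u; v] by rewrite -E set22.
    by rewrite in_set2 eq_sym => /predU1P[->|/eqP wv] //; rewrite wv eqxx in vw.
  + by move: vq; rewrite in_cons negb_or => /andP[].
  + by rewrite inE eq_sym.
  + move=> e; rewrite inE => /eqP->; apply: contraNN vq => /mem_path_edges_sub.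
    by apply; rewrite set21.
Qed.

Lemma edges_in_setT (G : sgraph) : edges_in [set: G] = edges G.
Proof. by apply/setP => e; rewrite inE subsetT andbT. Qed.

(** * Connectivity excludes one-vertex and repeated paths *)

Lemma perm_of_not_pairwise (T : eqType) (r : rel T) (s : seq T) :
  ~~ pairwise r s ->
  exists x y t, perm_eq s (x :: y :: t) /\ ~~ r x y.
Proof.
elim: s => [//|x s IHs]; rewrite pairwise_cons negb_and.
case/orP => [/allPn[y ys rxy]|/IHs[a [b [t [st rab]]]]].
  by exists x, y, (rem y s); rewrite perm_cons perm_to_rem.
exists a, b, (x :: t); split=> //.
rewrite -(permPr (permEl (perm_catCA [:: x] [:: a; b] t))).
by rewrite perm_cons.
Qed.

(** The set [[set x; y]] is closed under adjacency, hence is everything. The case [x = y] is allowed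
    and serves for one-vertex paths. *)
Lemma connected_pair (G : sgraph) (x y : G) : connected G ->
  (forall z, adj x z -> z = y) -> (forall z, adj y z -> z = x) -> #|G| <= 2.
Proof.
move=> hconn xN yN; apply: (@leq_trans #|[set x; y]|); last first.
  by rewrite cards2; case: (x != y).
apply: subset_leq_card; apply/subsetP => z _.
have cl : closed (@adj G) [set x; y].
  apply: intro_closed; first by move=> a b; apply: sym_connect_sym; apply: adj_sym.
  move=> a b ab; rewrite !in_set2 => /orP[]/eqP aE; rewrite aE in ab.
    by rewrite (xN _ ab) eqxx orbT.
  by rewrite (yN _ ab) eqxx.
by rewrite -(closed_connect cl (hconn x z)) set21.
Qed.

Lemma ends_le_sum (G : sgraph) (x : G) (P : seq (seq G)) p :
  p \in P -> ends x p <= \sum_(q <- P) ends x q.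
Proof. by move=> pP; rewrite (big_rem _ pP) leq_addr. Qed.

(** A path [[:: x]] uses both ends available at [x], so [ps_local] with [y = x] makes [x]
    isolated. *)
Lemma path_system_nontrivial (G : sgraph) P p :
  connected G -> 2 < #|G| -> path_system (edges G) P -> p \in P -> 1 < size p.
Proof.
move=> hconn G3 HP pP; rewrite ltnNge; apply/negP => p1.
have := allP (ps_path HP) p pP; case: p => [//|x [|//]] in pP p1 * => _.
suff xN z : adj x z -> z = x.
  by have := connected_pair hconn xN xN; rewrite leqNgt G3.
move=> xz; apply: (ps_local HP (x := x) (y := x)); last exact: mem_edges.
have PP := perm_to_rem pP.
have := ps_ends HP x; rewrite (perm_big _ PP) big_cons /= eqxx => sumP r.
rewrite (perm_mem PP) in_cons => /predU1P[-> _ t|/(ends_le_sum x) r1 r0]; last first.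
  by exfalso; move: sumP r1; set s := \sum_(j <- _) _; lia.
by rewrite !inE => ->.
Qed.

(** Two copies share all their edges, so by [ps_sep] they have a single edge [xy]. They use up the
    ends at [x] and at [y], and [ps_local] then cuts [x] and [y] off from all other vertices. *)
Lemma path_system_distinct (G : sgraph) P :
  connected G -> 2 < #|G| -> path_system (edges G) P ->
  pairwise (fun p q => ~~ same_path p q) P.
Proof.
move=> hconn G3 HP; apply/negPn/negP.
case/perm_of_not_pairwise=> p [q [P' [PP /negPn pq]]].
have {PP}HP := path_system_perm PP HP.
have qE e : (e \in path_edges q) = (e \in path_edges p).
  by case/orP: pq => /eqP->; rewrite ?mem_path_edges_rev.
have endsq x : ends x q = ends x p.
  by case/orP: pq => /eqP->; rewrite ?ends_rev.
have memq : q =i p by case/orP: pq => /eqP-> // x; rewrite mem_rev.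
have p2 := path_system_nontrivial hconn G3 HP (mem_head _ _).
have /andP[gp _] := ps_path HP.
case: p => [//|x [//|y [|z p]]] in HP p2 {pq} gp qE endsq memq *; last first.
  have := gp; rewrite graph_path_cons => /and3P[_ xyzp _].
  have xyz : [set x; y] != [set y; z].
    apply: contraNneq xyzp => E; have : x \in [set y; z] by rewrite -E set21.
    by rewrite in_set2 !in_cons => /orP[]->; rewrite ?orbT.
  by have := ps_sep HP xyz; rewrite /= !qE /= !in_cons !eqxx !orbT /=.
have xy : x != y by move: gp; rewrite graph_path_cons inE => /and3P[].
have sub a b : [set a; b] = [set x; y] -> a != b ->
    forall c, adj a c -> c = b.
  move=> E ab c ac; apply: (ps_local HP (x := a) (y := b)); last exact: mem_edges.
  have := ps_ends HP a; rewrite !big_cons endsq /= => sumP r.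
  have : a \in [set x; y] by rewrite -E set21.
  rewrite in_set2 (eq_sym a) (eq_sym a y) => axy.
  rewrite E !in_cons => /or3P[/eqP->|/eqP->|/(ends_le_sum a) r1] r0 t.
  - by rewrite !inE.
  - by rewrite memq !inE.
  - by exfalso; move: sumP r1 axy; set s := \sum_(j <- _) _; lia.
have yx : y != x by rewrite eq_sym.
by have := connected_pair hconn (sub x y erefl xy) (sub y x (setUC _ _) yx);
  rewrite leqNgt G3.
Qed.

(** * Strong separation and the conclusion *)

(** Of the two paths through [e], at most one contains [f]. *)
Lemma path_system_separated (G : sgraph) F P (e f : {set G}) :
  path_system F P -> e \in F -> e != f ->
  exists2 p, p \in P & (e \in path_edges p) && (f \notin path_edges p).
Proof.
move=> HP eF ef; apply/hasP; rewrite has_count.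
have := ps_cover HP e; have := ps_sep HP ef; rewrite eF.
have -> : count (fun p => e \in path_edges p) P =
    count (fun p => (e \in path_edges p) && (f \in path_edges p)) P +
    count (fun p => (e \in path_edges p) && (f \notin path_edges p)) P.
  elim: P {HP} => //= p P ->; case: (e \in _) => //=; case: (f \in _) => /=; lia.
by set a := count _ P; set b := count _ P; rewrite -[true.*2]/2; lia.
Qed.

Theorem theorem2p1 (G : sgraph) (n : nat) (hn : 3 <= n) (hG : #|G| = n)
    (hconn : connected G) (hdeg : degenerate 2 G) :
  exists P : seq (seq G),
    [/\ strongly_separating P,
        size P = n,
        (forall e : {set G}, e \in edges G ->
           count (fun p => e \in path_edges p) P = 2) &
        (forall v : G, count (fun p => endpoint v p) P = 2)].
Proof.
rewrite -hG in hn *; have [P] := path_system_edges_in [set: G] hdeg.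
rewrite edges_in_setT => HP; exists P; split.
- split; first by rewrite /path_collection (ps_path HP) path_system_distinct.
  move=> e f eG fG ef; split; first exact: path_system_separated HP eG ef.
  by apply: path_system_separated HP fG _; rewrite eq_sym.
- exact: ps_size HP.
- by move=> e eG; rewrite (ps_cover HP) eG.
(* Every path now has distinct first and last vertices, so [ends v p] is 0 or 1 and agrees with
   [endpoint v p]. *)
move=> v; rewrite -(ps_ends HP v) -sum1_count big_mkcond /=.
apply: eq_big_seq => p pP.
have := path_system_nontrivial hconn hn HP pP.
have := allP (ps_path HP) p pP.
case: p {pP} => [//|x [//|y p]]; rewrite graph_path_cons => /and3P[_ xp _] _.
have xl : x != last y p by apply: contraNneq xp => ->; apply: mem_last.
rewrite /= !(eq_sym v); have [<-|//] := eqVneq x v.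
by rewrite eq_sym (negPf xl).
Qed.
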